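(* Writing $\mathcal{O}=\mathcal{O}_{\mathbb{P}^3}$, there are no minimal monads on $\mathbb{P}^3$ of any of the following forms whose cohomology bundle is stable: (P5) $\ 2\cdot\mathcal{O}(-3)\to\mathcal{O}(2)\oplus2\cdot\mathcal{O}\oplus2\cdot\mathcal{O}(-1)\oplus\mathcal{O}(-3)\to2\cdot\mathcal{O}(2)$; (P11) $\ \mathcal{O}(-2)\oplus2\cdot\mathcal{O}(-3)\to\mathcal{O}(2)\oplus3\cdot\mathcal{O}\oplus3\cdot\mathcal{O}(-1)\oplus\mathcal{O}(-3)\to\mathcal{O}(1)\oplus2\cdot\mathcal{O}(2)$; (P18) $\ 3\cdot\mathcal{O}(-3)\to\mathcal{O}(2)\oplus2\cdot\mathcal{O}(1)\oplus\mathcal{O}\oplus\mathcal{O}(-1)\oplus2\cdot\mathcal{O}(-2)\oplus\mathcal{O}(-3)\to3\cdot\mathcal{O}(2)$.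
   Context: $\mathbb{P}^3$ is projective 3-space over an algebraically closed field of characteristic zero; $m\cdot\mathcal{L}$ denotes $\mathcal{L}^{\oplus m}$. Stability is slope stability. A monad is a complex of vector bundles $\mathcal{C}\xrightarrow{\beta}\mathcal{B}\xrightarrow{\alpha}\mathcal{A}$ with $\beta$ injective (and locally left invertible) and $\alpha$ surjective; its cohomology is the vector bundle $\ker\alpha/\operatorname{Im}\beta$. It is minimal if no direct summand of $\mathcal{A}$ is the image of a line subbundle of $\mathcal{B}$ and no direct summand of $\mathcal{C}$ goes onto a direct summand of $\mathcal{B}$. *)

(* Defs.v *)
(* Monads of split bundles on P^3 and slope stability of their cohomology.

   Write S = k[x_0, .., x_3].  A split bundle F = (+)_i O(F_i) is encoded by the
   sequence F of its twists, and a coherent subsheaf of F by a graded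
   S-submodule of (+)_i S(F_i), two submodules being the same subsheaf when they
   agree after localisation at every point.  As the saturated graded module of F
   is (+)_i S(F_i), every coherent subsheaf of F is obtained in this way, and
   every coherent subsheaf of a subquotient M / N of F comes from a graded
   submodule lying between N and M. *)
From mathcomp Require Import all_boot all_order all_algebra.
From mathcomp Require Import mpoly.
Set Implicit Arguments.
Unset Strict Implicit.
Unset Printing Implicit Defensive.
Import Order.TTheory GRing.Theory Num.Theory.
Local Open Scope ring_scope.

Section Monads.
Variable k : closedFieldType.
Local Notation S := {mpoly k[4]}.

(* f is in H^0(O(d)); for d < 0 only the zero form qualifies. *)
Definition is_form (d : int) (f : S) : bool :=
  if d is Posz n then f \is n.-homog else f == 0.

(* Homogeneous coordinates of a closed point of P^3. *)
Definition is_point (p : 'I_4 -> k) : Prop := exists i, p i != 0.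

(* H^0(F(n)). *)
Definition is_section (F : seq int) (n : int) (v : 'cV[S]_(size F)) : Prop :=
  forall i : 'I_(size F), is_form (F`_i + n) (v i 0).

(* M is a morphism F -> G(d); matrices act on column vectors. *)
Definition is_mor_twist (d : int) (F G : seq int) (M : 'M[S]_(size G, size F))
  : Prop := forall (i : 'I_(size G)) (j : 'I_(size F)),
  is_form (G`_i - F`_j + d) (M i j).

Definition is_mor (F G : seq int) := @is_mor_twist 0 F G.

(* [N n] is the degree n part of a graded submodule of (+)_i S(F_i). *)
Definition gsub (F : seq int) := int -> 'cV[S]_(size F) -> Prop.

Record graded_submodule (F : seq int) (N : gsub F) : Prop := GradedSubmodule {
  gsub_section : forall n v, N n v -> is_section n v;
  gsub0 : forall n, N n 0;
  gsubD : forall n u v, N n u -> N n v -> N n (u + v);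
  gsubZ : forall d n f v, is_form d f -> N n v -> N (d + n) (f *: v)
}.

Definition gsub_le (F : seq int) (N N' : gsub F) : Prop :=
  forall n v, N n v -> N' n v.

(* Inclusion of the associated subsheaves of F, tested on the stalks at all
   closed points. *)
Definition subsheaf_le (F : seq int) (N N' : gsub F) : Prop :=
  forall p, is_point p -> forall n v, N n v ->
  exists d h, [/\ is_form d h, h.@[p] != 0 & N' (d + n) (h *: v)].

Definition subsheaf_eq (F : seq int) (N N' : gsub F) : Prop :=
  subsheaf_le N N' /\ subsheaf_le N' N.

Definition full (F : seq int) : gsub F := fun n v => is_section n v.

Definition ker (F G : seq int) (M : 'M[S]_(size G, size F)) : gsub F :=
  fun n v => is_section n v /\ M *m v = 0.

Definition im (F G : seq int) (M : 'M[S]_(size G, size F)) : gsub G :=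
  fun n v => exists2 u : 'cV[S]_(size F), is_section n u & v = M *m u.

Definition sheaf_surjective (F G : seq int) (M : 'M[S]_(size G, size F)) :=
  subsheaf_le (@full G) (im M).

Definition sheaf_injective (F G : seq int) (M : 'M[S]_(size G, size F)) :=
  forall n v, ker M n v -> v = 0.

(* Near each point p there is a left inverse L / h, where h is a form with
   h(p) <> 0. *)
Definition locally_left_invertible (F G : seq int)
    (M : 'M[S]_(size G, size F)) : Prop :=
  forall p, is_point p -> exists d h (L : 'M[S]_(size F, size G)),
    [/\ is_form d h, h.@[p] != 0, is_mor_twist d L & L *m M = h%:M].

Record monad (C B A : seq int) (beta : 'M[S]_(size B, size C))
    (alpha : 'M[S]_(size A, size B)) : Prop := Monad {
  monad_mor_beta : is_mor beta;
  monad_mor_alpha : is_mor alpha;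
  monad_complex : alpha *m beta = 0;
  monad_inj : sheaf_injective beta;
  monad_loc_inv : locally_left_invertible beta;
  monad_surj : sheaf_surjective alpha
}.

(* Nonzero direct summands of F are the images of the nonzero idempotent
   endomorphisms of F. *)
Definition summand_proj (F : seq int) (pi : 'M[S]_(size F)) : Prop :=
  [/\ is_mor (F := F) (G := F) pi, pi *m pi = pi & pi != 0].

(* Every line bundle on P^3 is some O(d). *)
Definition line_subbundle (B : seq int) (d : int)
    (l : 'M[S]_(size B, size [:: d])) : Prop :=
  is_mor l /\ locally_left_invertible l.

Definition minimal (C B A : seq int) (beta : 'M[S]_(size B, size C))
    (alpha : 'M[S]_(size A, size B)) : Prop :=
  (~ exists d (l : 'M[S]_(size B, size [:: d])) (pi : 'M[S]_(size A)),
       [/\ line_subbundle l, summand_proj pi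
         & subsheaf_eq (im (alpha *m l)) (im (F := A) (G := A) pi)])
  /\
  (~ exists (pi : 'M[S]_(size C)) (rho : 'M[S]_(size B)),
       [/\ summand_proj pi, summand_proj rho
         & subsheaf_eq (im (F := C) (G := B) (beta *m pi))
                       (im (F := B) (G := B) rho)]).

(* The k-vector space M_n / N_n has dimension d: e is a basis of M_n modulo
   N_n. *)
Definition quo_dim (F : seq int) (M N : gsub F) (n : int) (d : nat) : Prop :=
  exists e : 'I_d -> 'cV[S]_(size F),
    [/\ forall i, M n (e i),
        forall v, M n v -> exists c : 'I_d -> k,
          N n (v - \sum_i (c i)%:MP *: e i)
      & forall c : 'I_d -> k, N n (\sum_i (c i)%:MP *: e i) ->
          forall i, c i = 0].

(* P is the Hilbert polynomial of the coherent sheaf associated with M / N. *)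
Definition hilbert_poly (F : seq int) (M N : gsub F) (P : {poly rat}) : Prop :=
  exists n0 : nat, forall n : nat, (n0 <= n)%N ->
  exists2 d : nat, quo_dim M N n%:Z d & P.[n%:R] = d%:R.

(* By Riemann-Roch the Hilbert polynomial of a coherent sheaf of rank r and
   degree c_1 = c on P^3 is  r n^3 / 6 + (c + 2 r) n^2 / 2 + lower terms. *)
Definition hrank (P : {poly rat}) : rat := 6%:R * P`_3.
Definition hdegree (P : {poly rat}) : rat := 2%:R * P`_2 - 2%:R * hrank P.
Definition slope (P : {poly rat}) : rat := hdegree P / hrank P.

(* Slope stability of the sheaf associated with M / N (a Hilbert polynomial
   always exists and is unique); M' / N runs through its coherent subsheaves. *)
Definition stable (F : seq int) (M N : gsub F) : Prop :=
  exists2 P : {poly rat}, hilbert_poly M N P &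
  forall (M' : gsub F) (P' : {poly rat}),
    graded_submodule M' -> gsub_le N M' -> gsub_le M' M ->
    hilbert_poly M' N P' ->
    0 < hrank P' < hrank P -> slope P' < slope P.

Definition has_stable_minimal_monad (C B A : seq int) : Prop :=
  exists (beta : 'M[S]_(size B, size C)) (alpha : 'M[S]_(size A, size B)),
    [/\ monad beta alpha, minimal beta alpha & stable (ker alpha) (im beta)].

End Monads.

Arguments has_stable_minimal_monad : clear implicits.

(* Main.v *)
Require Import Defs.
From mathcomp Require Import all_boot all_order all_algebra.
From mathcomp Require Import mpoly.
From mathcomp Require Import zify ring lra.
Set Implicit Arguments.
Unset Strict Implicit.
Unset Printing Implicit Defensive.
Import Order.TTheory GRing.Theory Num.Theory.
Local Open Scope ring_scope.

(** In each of the three monads the middle bundle B contains a summand O(2),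
    while every twist of A is at most 2 and every twist of C is less than 2.
    The restriction of alpha to O(2) then consists of constants, landing in the
    summands O(2) of A; if it were not zero, its image would be a direct summand
    of A, against minimality.  So O(2) lies in ker alpha.  It does not meet
    im beta, hence it embeds in the cohomology bundle E as a subsheaf of rank 1
    and degree 2.  As E has rank 2 and degree -1, it is not stable.  The
    argument is carried out for O(d) in [no_stable_minimal_monad].

    Two points need a proof: the value of the rank and degree of E, which are
    read off the coefficients of n^3 and n^2 of a Hilbert polynomial
    ([cohomology_rank_degree]), and the equality of O(d) /\ im beta with 0
    ([line_bundle_inter]).  Both are dimension counts in degree n in which
    errors of order n are harmless, and both rest on [cokernel_growth]: a graded
    submodule N of F = (+) S(F_i) which is all of F at every closed point has
    codimension O(n) in degree n.  (N contains all of F in high degrees, but that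
    takes the Nullstellensatz.)  For the O(n) bound it is enough to look at the
    line x_2 = x_3 = 0: there binary forms split into linear factors, and this
    yields F_n = N_n + x_2 F_(n-1) + x_3 F_(n-1) for large n.  Iterating from n
    down to a fixed n_0 leaves, modulo N_n, only the multiples of a basis of
    F_(n_0) by the n - n_0 + 1 monomials of degree n - n_0 in x_2 and x_3.

    For O(d) /\ im beta: if it contains a nonzero section, then the local left
    inverses of beta show that O(d) is contained in im beta at every point, so
    that the inverse image I of im beta in S(d) has codimension O(n).  On the
    other hand I has rank 1 inside C, so one coordinate of C = (+) S(c_j) embeds
    it in some S(c_j) with c_j < d, and the dimensions of S(d)_n and S(c_j)_n
    differ by (d - c_j) n^2 / 2 + O(n). *)

(** * Linear algebra with families modulo a subspace *)

Section LinearAlgebra.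
Variables (k : fieldType) (n : nat).
Local Notation S := {mpoly k[n]}.

(** The kernel of a matrix indexed by finite types, the rows of [Y] being
    a basis of it. *)
Lemma exists_kernel_family (I J : finType) (X : I -> J -> k) :
  exists r (Y : 'I_r -> I -> k),
    [/\ (#|I| <= r + #|J|)%N,
        forall s j, \sum_i Y s i * X i j = 0
      & forall c : 'I_r -> k, (forall i, \sum_s c s * Y s i = 0) ->
          forall s, c s = 0].
Proof.
pose A : 'M[k]_(#|I|, #|J|) := \matrix_(a, b) X (enum_val a) (enum_val b).
pose Z := row_base (kermx A).
exists (\rank (kermx A)), (fun s i => Z s (enum_rank i)); split.
- by rewrite mxrank_ker; have := rank_leq_col A; lia.
- move=> s j.
  have /sub_kermxP/matrixP/(_ s (enum_rank j)) : (Z <= kermx A)%MS.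
    by rewrite eq_row_base.
  rewrite !mxE => H; rewrite -[RHS]H (reindex (fun a : 'I_#|I| => enum_val a)) /=; last first.
    by apply: onW_bij; apply: enum_val_bij.
  by apply: eq_bigr => a _; rewrite !mxE !enum_valK enum_rankK.
- move=> c Hc s.
  have freeZ : row_free Z by apply: row_base_free.
  have: \row_s c s *m Z = 0.
    apply/matrixP=> a b; rewrite ord1 !mxE -{}[RHS](Hc (enum_val b)).
    by apply: eq_bigr => t _; rewrite !mxE enum_valK.
  rewrite -(mul0mx _ Z) => /(row_free_inj freeZ)/matrixP/(_ 0 s).
  by rewrite !mxE.
Qed.

(** The modules met below are modules over the polynomial ring; the following
    notions only use the action of the constants. *)
Record ksubspace (V : lmodType S) (N : V -> Prop) : Prop := KSubspace {
  ksub0 : N 0;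
  ksubD : forall u v, N u -> N v -> N (u + v);
  ksubZ : forall (c : k) v, N v -> N (c%:MP *: v)
}.

Definition klin (V : lmodType S) (I : finType) (c : I -> k) (e : I -> V) : V :=
  \sum_i (c i)%:MP *: e i.

Definition kfree (V : lmodType S) (N : V -> Prop) (I : finType) (e : I -> V) :=
  forall c : I -> k, N (klin c e) -> forall i, c i = 0.

Definition kspan (V : lmodType S) (M N : V -> Prop) (I : finType) (e : I -> V) :=
  forall v, M v -> exists c : I -> k, N (v - klin c e).

Definition zerov (V : lmodType S) : V -> Prop := fun v => v = 0.

Section Families.
Variable V : lmodType S.
Implicit Types (M N : V -> Prop) (I J : finType).

Lemma zerov_ksub : ksubspace (@zerov V).
Proof.
split=> [//|u v -> ->|c v ->]; rewrite /zerov ?addr0 //.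
by rewrite scaler0.
Qed.

Lemma ksubN N v : ksubspace N -> N v -> N (- v).
Proof. by move=> kN /(ksubZ kN (-1)); rewrite mpolyCN scaleN1r. Qed.

Lemma ksubB N u v : ksubspace N -> N u -> N v -> N (u - v).
Proof. by move=> kN Nu Nv; apply: ksubD => //; apply: ksubN. Qed.

Lemma ksub_sum N I (F : I -> V) :
  ksubspace N -> (forall i, N (F i)) -> N (\sum_i F i).
Proof.
by move=> kN NF; elim/big_ind: _ => //; [apply: ksub0|apply: ksubD].
Qed.

Lemma ksub_klin N I (c : I -> k) (e : I -> V) :
  ksubspace N -> (forall i, N (e i)) -> N (klin c e).
Proof. by move=> kN Ne; apply: ksub_sum => // i; apply: ksubZ. Qed.

Lemma klin_comp I J (c : J -> k) (Y : J -> I -> k) (e : I -> V) :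
  klin c (fun s => klin (Y s) e) = klin (fun i => \sum_s c s * Y s i) e.
Proof.
rewrite /klin; under eq_bigr do rewrite scaler_sumr.
rewrite exchange_big; apply: eq_bigr => i _ /=.
rewrite raddf_sum scaler_suml; apply: eq_bigr => s _.
by rewrite scalerA -mpolyCM.
Qed.

Lemma klin0 I (e : I -> V) (c : I -> k) : (forall i, c i = 0) -> klin c e = 0.
Proof. by move=> c0; apply: big1 => i _; rewrite c0 mpolyC0 scale0r. Qed.

Lemma klin_sum (I J : finType) (c : I + J -> k) (e : I + J -> V) :
  klin c e = klin (c \o inl) (e \o inl) + klin (c \o inr) (e \o inr).
Proof. by rewrite /klin big_sumType. Qed.

(** Expressing [e] modulo [N] through a smaller family [f] forces elements
    of [N] into the span of [e]: the kernel of the matrix of coefficients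
    provides at least [#|I| - #|J|] of them, with independent coefficients. *)
Lemma exists_relations N I J (e : I -> V) (f : J -> V) :
  ksubspace N -> (forall i, exists c : J -> k, N (e i - klin c f)) ->
  exists r (Y : 'I_r -> I -> k),
    [/\ (#|I| <= r + #|J|)%N,
        forall s, N (klin (Y s) e)
      & forall c : 'I_r -> k, (forall i, \sum_s c s * Y s i = 0) ->
          forall s, c s = 0].
Proof.
move=> kN /fin_all_exists[X HX].
have [r [Y [le_r YX freeY]]] := exists_kernel_family X.
exists r, Y; split=> // s.
have -> : klin (Y s) e = \sum_i (Y s i)%:MP *: (e i - klin (X i) f).
  under [RHS]eq_bigr do rewrite scalerBr.
  rewrite sumrB -/(klin _ (fun i => klin (X i) f)) klin_comp.
  by rewrite [X in _ - X]klin0 ?subr0.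
by apply: ksub_sum => // i; apply: ksubZ.
Qed.

Lemma kfree_leq_kspan N I J (e : I -> V) (f : J -> V) :
  ksubspace N -> (forall i, exists c : J -> k, N (e i - klin c f)) ->
  kfree N e -> (#|I| <= #|J|)%N.
Proof.
move=> kN Hspan free_e.
have [[|r] [Y [le_r NY freeY]]] := exists_relations kN Hspan; first by rewrite add0n in le_r.
have := freeY (fun _ => 1); case: (pickP 'I_r.+1) => [s _|/(_ ord0)//].
move/(_ _ s)/eqP; rewrite oner_eq0 => H; exfalso; apply/notF/H => i.
by apply: big1 => t _; rewrite (free_e _ (NY t)) mulr0.
Qed.

End Families.

Lemma klin_morph (V W : lmodType S) (phi : {linear V -> W}) (I : finType)
    (c : I -> k) (e : I -> V) : phi (klin c e) = klin c (phi \o e).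
Proof. by rewrite /klin linear_sum; apply: eq_bigr => i _; rewrite linearZ. Qed.

End LinearAlgebra.

(** * Bases of the spaces of forms and of sections of split bundles *)

Section Forms.
Variable k : closedFieldType.
Local Notation S := {mpoly k[4]}.

Lemma is_form0 d : @is_form k d 0.
Proof. by case: d => m /=; rewrite ?eqxx ?rpred0. Qed.

Lemma is_formD d (f g : S) : is_form d f -> is_form d g -> is_form d (f + g).
Proof.
by case: d => m /=; [apply: rpredD | move=> /eqP-> /eqP->; rewrite addr0].
Qed.

Lemma is_formM d e (f g : S) :
  is_form d f -> is_form e g -> is_form (d + e) (f * g).
Proof.
case: d e => [m|m] [p|p].
- exact: dhomogM.
- by move=> _ /eqP->; rewrite mulr0 is_form0.
- by move=> /eqP-> _; rewrite mul0r is_form0.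
- by move=> /eqP-> _; rewrite mul0r is_form0.
Qed.

Lemma is_formC (c : k) : is_form 0 (c%:MP : S).
Proof.
rewrite /= -[c%:MP]mulr1 mul_mpolyC; apply: dhomogZ; exact: dhomog1.
Qed.

Lemma is_formZ d (c : k) (f : S) : is_form d f -> is_form d (c%:MP * f).
Proof. by move/(is_formM (is_formC c)); rewrite add0r. Qed.

Lemma is_formN d (f : S) : is_form d f -> is_form d (- f).
Proof. by move/(is_formZ (-1)); rewrite mpolyCN mulN1r. Qed.

Lemma is_formB d (f g : S) : is_form d f -> is_form d g -> is_form d (f - g).
Proof. by move=> ff fg; apply: is_formD => //; apply: is_formN. Qed.

Lemma is_form_sum d (I : finType) (P : pred I) (F : I -> S) :
  (forall i, P i -> is_form d (F i)) -> is_form d (\sum_(i | P i) F i).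
Proof.
by move=> HF; elim/big_ind: _ => //; [apply: is_form0 | apply: is_formD].
Qed.

Lemma is_formX i : is_form 1 ('X_i : S).
Proof. by rewrite /= dhomogX; apply/eqP; exact: mdeg1. Qed.

Lemma is_form_const (f : S) : is_form 0 f -> exists c : k, f = c%:MP.
Proof.
move=> /= /dhomogP hf; exists f@_0%MM; apply/mpolyP => m.
rewrite mcoeffC; case: eqP => [->|ne]; first by rewrite mulr1.
rewrite mulr0; apply: memN_msupp_eq0; apply/negP => /hf /eqP.
by rewrite mdeg_eq0 => /eqP/ne.
Qed.

Lemma is_form_lt0 d (f : S) : d < 0 -> is_form d f -> f = 0.
Proof. by case: d => // m _ /eqP. Qed.

(** The dimension of H^0(O(d)) on P^3. *)
Definition dim_forms (d : int) : nat := if d is Posz m then 'C(m + 3, 3) else 0.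

Lemma forms_basis d : exists (I : finType) (e : I -> S),
  [/\ #|I| = dim_forms d, forall i, is_form d (e i),
      forall f, is_form d f -> exists c : I -> k, f = \sum_i (c i)%:MP * e i
    & forall c : I -> k, \sum_i (c i)%:MP * e i = 0 -> forall i, c i = 0].
Proof.
case: d => m; last first.
  exists 'I_0, (fun _ => 0); split; rewrite ?card_ord //=.
  - by move=> f /eqP ->; exists (fun _ => 0); rewrite big_ord0.
  - by move=> c _ [].
pose T := dhomog 4 k m.
pose b := vbasis (fullv : {vspace T}).
exists 'I_(\dim (fullv : {vspace T})), (fun i : 'I__ => mpoly_of_dhomog b`_i); split.
- rewrite card_ord dimvf /= -bin_sub; last by rewrite leq_addl.
  by rewrite addnK.
- by move=> i /=; apply: dhomog_is_dhomog.
- move=> f hf; pose v : T := DHomog hf.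
  exists (fun i => coord b i v).
  have {1}-> : f = mpoly_of_dhomog v by [].
  rewrite {1}(coord_vbasis (memvf v)) linear_sum; apply: eq_bigr => i _.
  by rewrite linearZ /= mul_mpolyC.
- move=> c Hc.
  have /freeP : free b by apply: basis_free (vbasisP _).
  apply; apply: val_inj => /=; rewrite linear_sum -[RHS]Hc.
  by apply: eq_bigr => i _; rewrite linearZ /= mul_mpolyC.
Qed.

Lemma section_ksub (F : seq int) n : ksubspace (@is_section k F n).
Proof.
split.
- by move=> i; rewrite mxE is_form0.
- by move=> u v hu hv i; rewrite mxE is_formD.
- by move=> c v hv i; rewrite mxE is_formZ.
Qed.

Lemma sectionZ (F : seq int) d n f v :
  is_form d f -> @is_section k F n v -> @is_section k F (d + n) (f *: v).
Proof.
by move=> hf hv i; rewrite mxE (_ : F`_i + _ = d + (F`_i + n)) ?is_formM //; ring.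
Qed.

Lemma mor_section (F G : seq int) (M : 'M[S]_(size G, size F)) d n v :
  is_mor_twist d M -> is_section n v -> is_section (d + n) (M *m v).
Proof.
move=> hM hv i; rewrite mxE; apply: is_form_sum => j _.
rewrite (_ : G`_i + (d + n) = (G`_i - F`_j + d) + (F`_j + n)) ?is_formM //.
by ring.
Qed.

Definition dim_sections (F : seq int) (n : int) : nat :=
  \sum_(d <- F) dim_forms (d + n).

(** A basis of H^0(F(n)) is made of the bases of its summands H^0(O(F_i + n));
    it is indexed by the pairs of a summand and an element of its basis. *)
Lemma sections_basis (F : seq int) n :
  exists (I : finType) (e : I -> 'cV[S]_(size F)),
  [/\ #|I| = dim_sections F n, forall i, is_section n (e i),
      kspan (@is_section k F n) (@zerov _ _ _) e
    & kfree (@zerov _ _ _) e].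
Proof.
have [T HT] := fin_all_exists (fun i : 'I_(size F) => forms_basis (F`_i + n)).
have [b {}HT] := fin_all_exists HT.
pose e (p : {i : 'I_(size F) & T i}) : 'cV[S]_(size F) :=
  \col_j (if j == tag p then b (tag p) (tagged p) else 0).
have klinE (c : {i : 'I_(size F) & T i} -> k) i :
    klin c e i 0 = \sum_(j : T i) (c (Tagged T j))%:MP * b i j.
  rewrite /klin summxE.
  pose G i' (j : T i') := ((c (Tagged T j))%:MP *: e (Tagged T j)) i 0.
  transitivity (\sum_(p : {i : 'I_(size F) & T i}) G (tag p) (tagged p)).
    by apply: eq_bigr => -[i' j] _.
  rewrite -(sig_big_dep xpredT (fun _ => xpredT) G) /= /G.
  rewrite (bigD1 i) //= [X in _ + X]big1 ?addr0; last first.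
    by move=> i' ne; apply: big1 => j _; rewrite !mxE eq_sym (negbTE ne) mulr0.
  by apply: eq_bigr => j _; rewrite !mxE eqxx.
exists {i : 'I_(size F) & T i}, e; split.
- rewrite card_tagged sumnE big_map /dim_sections (big_nth 0) big_mkord.
  rewrite big_enum /=.
  by apply: eq_bigr => i _; case: (HT i) => ->.
- move=> [i j] l; rewrite mxE /=; case: eqP => [->|_]; last exact: is_form0.
  by case: (HT i).
- move=> v hv.
  have /fin_all_exists[c Hc] : forall i, exists c : T i -> k,
      v i 0 = \sum_j (c j)%:MP * b i j by move=> i; case: (HT i) => _ _ + _; apply.
  exists (fun p => c (tag p) (tagged p)); rewrite /zerov.
  apply/matrixP => i z; rewrite ord1 !mxE klinE /= -Hc.
  by rewrite subrr.
- move=> c Hc [i j]; case: (HT i) => _ _ _ /(_ (fun j => c (Tagged T j))).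
  by apply; rewrite -klinE Hc mxE.
Qed.

End Forms.

(** * Hilbert polynomials of split bundles *)

(** This is why errors of order n do not affect rank and degree: they leave the
    coefficients of n^2 and n^3 of a Hilbert polynomial unchanged. *)
Lemma size_leq2_linear_growth (p : {poly rat}) (c : rat) (n0 : nat) :
  (forall n, (n0 <= n)%N -> `|p.[n%:R]| <= c * n.+1%:R) -> (size p <= 2)%N.
Proof.
move=> Hp; rewrite leqNgt; apply/negP => lt2.
have [s Es] : exists s, size p = s.+3 by exists (size p - 3)%N; lia.
pose M := \sum_(i < s.+2) `|p`_i|.
have a0 : 0 < `|lead_coef p|.
  by rewrite normr_gt0 lead_coef_eq0 -size_poly_eq0 Es.
have c0 : 0 <= c.
  have := le_trans (normr_ge0 _) (Hp n0 (leqnn _)).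
  by rewrite pmulr_lge0 // ltr0n.
have bound (n : nat) : (n0 < n)%N -> `|lead_coef p| * n%:R <= 2%:R * c + M.
  move=> lt_n; have n1 : 1 <= n%:R :> rat by rewrite ler1n; lia.
  have n0' : 0 < n%:R :> rat by apply: lt_le_trans n1.
  have pw : 0 < n%:R ^+ s.+1 :> rat by apply: exprn_gt0.
  rewrite -(ler_pM2r pw) -mulrA -exprS mulrDl.
  have := Hp n (ltnW lt_n).
  have low : `|\sum_(i < s.+2) p`_i * n%:R ^+ i| <= M * n%:R ^+ s.+1.
    apply: le_trans (ler_norm_sum _ _ _) _; rewrite mulr_suml.
    apply: ler_sum => i _; rewrite normrM ler_wpM2l // ger0_norm ?exprn_ge0 ?(ltW n0') //.
    by apply: ler_weXn2l => //; have := ltn_ord i; lia.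
  have lin : c * n.+1%:R <= 2%:R * c * n%:R ^+ s.+1.
    rewrite (mulrC 2%:R) -mulrA ler_wpM2l //.
    apply: (@le_trans _ _ (2%:R * n%:R)).
      by rewrite -natrM ler_nat; lia.
    by rewrite ler_wpM2l // exprS ler_peMr ?(ltW n0') // exprn_ege1.
  rewrite horner_coef Es big_ord_recr /= (_ : p`_s.+2 = lead_coef p); last by rewrite lead_coefE Es.
  move=> H; rewrite -[X in `|_| * X <= _]ger0_norm ?exprn_ge0 ?(ltW n0') // -normrM.
  set q := \sum_(i < _) _ in low H; set r := lead_coef p * _ in H *.
  have -> : r = (q + r) - q by ring.
  apply: le_trans (ler_normB _ _) _; lra.
pose B := (2%:R * c + M) / `|lead_coef p|.
have M0 : 0 <= M by apply: sumr_ge0.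
have B0 : 0 <= B by rewrite divr_ge0 ?addr_ge0 ?mulr_ge0 // ltW.
have := bound (Num.bound B + n0.+1)%N (ltn_addl _ (ltnSn _)).
rewrite -ler_pdivlMl // mulrC -/B leNgt natrD => /negP; apply.
by apply: lt_le_trans (archi_boundP B0) _; rewrite lerDl ler0n.
Qed.

(** The binomial coefficient [(x + d + 1)(x + d + 2)(x + d + 3) / 6], expanded
    in the shape [((x + e) ^ 3 - (x + e)) / 6]. *)
Definition dim_poly (d : int) : {poly rat} :=
  let e : rat := d%:~R + 2%:R in
  Poly [:: (e ^+ 3 - e) / 6%:R; (3%:R * e ^+ 2 - 1) / 6%:R; e / 2%:R; 6%:R^-1].

Lemma dim_polyE d (n : nat) :
  0 <= d + n%:Z -> (dim_poly d).[n%:R] = (dim_forms (d + n%:Z))%:R.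
Proof.
rewrite /dim_poly horner_Poly /=.
case E: (d + n%:Z) => [m|//] _ /=.
have -> : n%:R = m%:R - d%:~R :> rat.
  rewrite !pmulrn -mulrzBr; congr (_%:~R); lia.
have : ('C(m.+3, 3) * 6 = m.+3 * (m.+2 * m.+1))%N.
  by rewrite -[6%N]/(3`!) bin_ffact !ffactSS ffactn0 muln1.
move/(congr1 (fun x => x%:R : rat)); rewrite !natrM addn3 => H.
have -> : ('C(m.+3, 3))%:R = (m.+3%:R * (m.+2%:R * m.+1%:R)) / 6%:R :> rat.
  by rewrite -H mulfK.
by rewrite -[m.+3]addn3 -[m.+2]addn2 -[m.+1]addn1 !natrD; field.
Qed.

Definition sections_poly (F : seq int) : {poly rat} := \sum_(d <- F) dim_poly d.

Lemma sections_polyE F (n : nat) : (forall d, d \in F -> 0 <= d + n%:Z) ->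
  (sections_poly F).[n%:R] = (dim_sections F n%:Z)%:R.
Proof.
move=> HF; rewrite /sections_poly horner_sum /dim_sections natr_sum.
by rewrite !big_seq; apply: eq_bigr => d /HF; apply: dim_polyE.
Qed.

Lemma hrank_sections F : hrank (sections_poly F) = (size F)%:R.
Proof.
rewrite /hrank /sections_poly coef_sum (eq_bigr (fun _ => 6%:R^-1)).
  by rewrite big_const_seq count_predT iter_addr_0 -[_^-1 *+ _]mulr_natl mulrC mulfVK.
by move=> d _; rewrite coef_Poly.
Qed.

Lemma hdegree_sections F :
  hdegree (sections_poly F) = (\sum_(d <- F) d)%:~R.
Proof.
rewrite /hdegree hrank_sections /sections_poly coef_sum.
rewrite (eq_bigr (fun d : int => d%:~R / 2%:R + 1)); last first.
  by move=> d _; rewrite coef_Poly /=; field.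
rewrite big_split /= -mulr_suml big_const_seq count_predT iter_addr_0.
by rewrite rmorph_sum /=; field.
Qed.

(** * Submodules that are everything at each point *)

Section Line.
Variable k : closedFieldType.
Local Notation S := {mpoly k[4]}.
Local Notation x i := ('X_i : S).
Local Notation x0 := (x 0).
Local Notation x1 := (x 1).
Local Notation x2 := (x 2%:R).
Local Notation x3 := (x 3%:R).

(** Points of the line x_2 = x_3 = 0, and the linear form on this line that
    vanishes at [(t : 1)]. *)
Definition line_point (a b : k) : 'I_4 -> k :=
  fun i => if i == 0 then a else if i == 1 then b else 0.

Definition line_form (t : k) : S := x0 - t%:MP * x1.

Lemma line_point_inf : is_point (line_point 1 0).
Proof. by exists 0; rewrite /line_point eqxx oner_eq0. Qed.

Lemma line_point_fin t : is_point (line_point t 1).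
Proof. by exists 1; rewrite /line_point /= oner_eq0. Qed.

(** The degree [m] part of the homogeneous ideal of [(t : 1 : 0 : 0)]. *)
Definition point_ideal (t : k) (m : int) (g : S) : Prop :=
  exists g1 g2 g3, [/\ is_form (m - 1) g1, is_form (m - 1) g2,
    is_form (m - 1) g3 & g = line_form t * g1 + x2 * g2 + x3 * g3].

Lemma point_ideal0 t m : point_ideal t m 0.
Proof. by exists 0, 0, 0; split; rewrite ?is_form0 // !mulr0 !addr0. Qed.

Lemma point_idealD t m f g :
  point_ideal t m f -> point_ideal t m g -> point_ideal t m (f + g).
Proof.
move=> [f1 [f2 [f3 [h1 h2 h3 ->]]]] [g1 [g2 [g3 [h1' h2' h3' ->]]]].
exists (f1 + g1), (f2 + g2), (f3 + g3); split; try exact: is_formD.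
ring.
Qed.

Lemma point_idealM t m d f g :
  point_ideal t m g -> is_form d f -> point_ideal t (d + m) (f * g).
Proof.
move=> [g1 [g2 [g3 [h1 h2 h3 ->]]]] hf.
exists (f * g1), (f * g2), (f * g3).
split; try by rewrite -addrA; apply: is_formM.
ring.
Qed.

(* Modulo the ideal of q = (t : 1 : 0 : 0), a form f of degree m should become
   f(q) x_1 ^ m.  As this property is stable under sums and products, it only has
   to be checked on constants and variables. *)
Let reduces t (m : nat) (f : S) : Prop :=
  is_form m f /\
  point_ideal t m (f - (f.@[line_point t 1])%:MP * x1 ^+ m).

Let reducesD t m f g : reduces t m f -> reduces t m g -> reduces t m (f + g).
Proof.
move=> [hf cf] [hg cg]; split; first exact: is_formD.
rewrite mevalD mpolyCD.
have -> : f + g - ((f.@[line_point t 1])%:MP + (g.@[line_point t 1])%:MP) * x1 ^+ m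
  = (f - (f.@[line_point t 1])%:MP * x1 ^+ m)
    + (g - (g.@[line_point t 1])%:MP * x1 ^+ m) by ring.
exact: point_idealD.
Qed.

Lemma is_form_Xn i (m : nat) : is_form m (x i ^+ m).
Proof. by have := dhomogMn m (is_formX k i); rewrite mul1n. Qed.

Let reducesM t (m p : nat) f g :
  reduces t m f -> reduces t p g -> reduces t (m + p) (f * g).
Proof.
move=> [hf cf] [hg cg]; split; first by rewrite PoszD is_formM.
rewrite mevalM mpolyCM exprD.
set a := _%:MP in cf *; set b := _%:MP in cg *.
have -> : f * g - a * b * (x1 ^+ m * x1 ^+ p)
  = g * (f - a * x1 ^+ m) + a * x1 ^+ m * (g - b * x1 ^+ p) by ring.
apply: point_idealD; first by rewrite PoszD addrC; apply: point_idealM.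
by rewrite PoszD; apply: point_idealM => //; apply/is_formZ/is_form_Xn.
Qed.

Let reducesC t c : reduces t 0 c%:MP.
Proof.
split; first exact: is_formC.
by rewrite mevalC expr0 mulr1 subrr; apply: point_ideal0.
Qed.

Let reducesX t i : reduces t 1 (x i).
Proof.
split; first exact: is_formX.
rewrite mevalXU expr1 /line_point.
have f1 : is_form (1 - 1) (1 : S) by rewrite subrr -mpolyC1 is_formC.
have f0 : is_form (1 - 1) (0 : S) by rewrite is_form0.
case: (eqVneq i 0) => [->|i0].
  by exists 1, 0, 0; split=> //; rewrite /line_form; ring.
case: (eqVneq i 1) => [->|i1].
  by rewrite mpolyC1 mul1r subrr; apply: point_ideal0.
rewrite mpolyC0 mul0r subr0.
have [->|->] : i = 2%:R \/ i = 3%:R.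
- case: i i0 i1 => -[|[|[|[|//]]]] i4 // _ _; [left|right]; exact: val_inj.
- by exists 0, 1, 0; split=> //; ring.
- by exists 0, 0, 1; split=> //; ring.
Qed.

(** A form of degree [m] is congruent to its value at [(t : 1 : 0 : 0)] times
    [x_1 ^ m] modulo the linear forms vanishing there. *)
Lemma form_point_ideal t m (g : S) :
  is_form m g -> g.@[line_point t 1] = 0 -> point_ideal t m g.
Proof.
case: m => m hg g0; last by rewrite (eqP hg); apply: point_ideal0.
suff [_] : reduces t m g by rewrite g0 mpolyC0 mul0r subr0.
rewrite [g]mpolyE big_seq.
elim/big_ind: _ => [|f h|M supM]; [|exact: reducesD|].
  split; first exact: is_form0.
  by rewrite meval0 mpolyC0 mul0r subr0; apply: point_ideal0.
rewrite -mul_mpolyC -[m]add0n; apply: reducesM; first exact: reducesC.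
have <- : mdeg M = m by move/dhomogP: hg => /(_ _ supM).
rewrite mpolyXE_id mdegE; elim/big_ind2: _ => [|? ? ? ?|i _].
- by rewrite -mpolyC1; apply: reducesC.
- exact: reducesM.
elim: (M i) => [|p IH]; first by rewrite expr0 -mpolyC1; apply: reducesC.
by rewrite exprS -add1n; apply: reducesM.
Qed.

(** The value at [(1 : 0)] of the binary form induced by [H] on the line is the
    leading coefficient of its dehomogenisation, which therefore is not constant
    and has a root. *)
Lemma form_line_root (m : nat) (H : S) : is_form m.+1 H ->
  H.@[line_point 1 0] != 0 -> exists t, H.@[line_point t 1] = 0.
Proof.
move=> hH H0.
have evE a b (M : 'X_{1..4}) : \prod_i line_point a b i ^+ M i =
    a ^+ M 0 * (b ^+ M 1 * (0 ^+ M 2%:R * 0 ^+ M 3%:R)).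
  rewrite !big_ord_recl big_ord0 mulr1 /line_point /=.
  by congr (_ ^+ M _ * (_ ^+ M _ * (_ ^+ M _ * _ ^+ M _))); apply: val_inj.
pose p : {poly k} := \sum_(M <- msupp H)
  (H@_M * (0 ^+ M 2%:R * 0 ^+ M 3%:R)) *: 'X^(M 0).
have pE t : p.[t] = H.@[line_point t 1].
  rewrite horner_sum mevalE; apply: eq_bigr => M _.
  by rewrite evE expr1n mul1r hornerZ hornerXn -mulrA (mulrC (t ^+ _)).
have lead : p`_m.+1 = H.@[line_point 1 0].
  rewrite coef_sum mevalE !big_seq; apply: eq_bigr => M supM.
  rewrite evE expr1n mul1r coefZ coefXn.
  have := dhomogP _ _ _ hH M supM; rewrite /= mdegE.
  rewrite !big_ord_recl big_ord0 addn0 /=.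
  have -> : lift ord0 ord0 = 1 :> 'I_4 by apply: val_inj.
  have -> : lift ord0 (lift ord0 ord0) = 2%:R :> 'I_4 by apply: val_inj.
  have -> : lift ord0 (lift ord0 (lift ord0 ord0)) = 3%:R :> 'I_4.
    by apply: val_inj.
  move=> degM; rewrite -mulrA; congr (_ * _).
  case: eqP => [E|ne]; last first.
    rewrite mulr0; case: (M 1) (M 2%:R) (M 3%:R) degM => [|a] [|b] [|c] degM;
      rewrite ?exprS ?mul0r ?mulr0 ?mul0r //.
    by case: ne; rewrite -degM !addn0.
  have -> : M 1 = 0%N.
    move: degM; rewrite -[M ord0]/(M 0) -E.
    by move: (M 1) (M 2%:R + M 3%:R)%N => a b; lia.
  by rewrite mulr1 expr0 mul1r.
case: (closed_rootP p _) => [|t /rootP]; last by exists t; rewrite -pE.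
apply/negP => /eqP sp; move: H0; rewrite -lead.
by rewrite nth_default ?eqxx // sp.
Qed.

End Line.

Section CokernelBound.
Variable k : closedFieldType.
Local Notation S := {mpoly k[4]}.
Local Notation x i := ('X_i : S).
Local Notation x2 := (x 2%:R).
Local Notation x3 := (x 3%:R).
Variables (F : seq int) (N : gsub k F).
Hypotheses (gN : graded_submodule N) (fullN : subsheaf_le (@full k F) N).
Local Notation A := (@is_section k F).

(* N + (x_2, x_3) F, whose quotient lives on the line x_2 = x_3 = 0 *)
Let N' : gsub k F := fun n v => exists w v2 v3,
  [/\ N n w, A (n - 1) v2, A (n - 1) v3 & v = w + x2 *: v2 + x3 *: v3].

Let gN' : graded_submodule N'.
Proof.
have sub1 d n (w : 'cV[S]_(size F)) : A (d + (n - 1)) w -> A (d + n - 1) w.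
  by rewrite addrA.
split.
- move=> n v [w [v2 [v3 [Nw h2 h3 ->]]]].
  have sx i u : A (n - 1) u -> A n (x i *: u).
    by move/(sectionZ (is_formX _ i)); rewrite addrC subrK.
  by do 2?[apply: (ksubD (section_ksub k F n))]; [apply: gsub_section Nw|apply: sx..].
- move=> n; exists 0, 0, 0; split; rewrite ?scaler0 ?addr0 //.
  + exact: gsub0.
  + exact: (ksub0 (section_ksub k F _)).
  + exact: (ksub0 (section_ksub k F _)).
- move=> n u v [w [v2 [v3 [Nw h2 h3 ->]]]] [w' [v2' [v3' [Nw' h2' h3' ->]]]].
  exists (w + w'), (v2 + v2'), (v3 + v3'); split.
  + exact: gsubD.
  + exact: (ksubD (section_ksub k F _)).
  + exact: (ksubD (section_ksub k F _)).
  + by rewrite !scalerDr addrACA (addrACA w).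
- move=> d n f v hf [w [v2 [v3 [Nw h2 h3 ->]]]].
  exists (f *: w), (f *: v2), (f *: v3); split.
  + exact: gsubZ.
  + exact/sub1/sectionZ.
  + exact/sub1/sectionZ.
  + by rewrite !scalerDr !scalerA ![f * _]mulrC.
Qed.

Let NN' n v : N n v -> N' n v.
Proof.
move=> Nv; exists v, 0, 0; split; rewrite ?scaler0 ?addr0 //;
exact: (ksub0 (section_ksub k F _)).
Qed.

Let x23N' (n : int) u v : A (n - 1) u -> A (n - 1) v -> N' n (x2 *: u + x3 *: v).
Proof. by move=> hu hv; exists 0, u, v; split; rewrite ?add0r //; apply: gsub0. Qed.

Let basis_section (i : 'I_(size F)) : A (- F`_i) (delta_mx i 0 : 'cV[S]_(size F)).
Proof.
move=> j; rewrite mxE andbT; case: eqP => [->|_]; last exact: is_form0.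
by rewrite subrr -mpolyC1 is_formC.
Qed.

Let local_gens p : is_point p -> exists (d : 'I_(size F) -> int) (h : 'I_(size F) -> S),
  forall i, [/\ is_form (d i) (h i), (h i).@[p] != 0
    & N (d i - F`_i) (h i *: delta_mx i 0)].
Proof.
move=> pp.
have /fin_all_exists[d /fin_all_exists[h H]] := fun i => fullN pp (@basis_section i).
by exists d, h.
Qed.

Let sum_basis (v : 'cV[S]_(size F)) : v = \sum_i v i 0 *: delta_mx i 0.
Proof.
rewrite [LHS]matrix_sum_delta; apply: eq_bigr => i _.
by rewrite big_ord1.
Qed.

(* At q = (t : 1 : 0 : 0) there are h_i e_i in N with h_i(q) <> 0, and a multiple
   of h_i by a power of x_1 takes at q the value of any given form. *)
Let quotient_line_point t : exists n1 : int, forall n : int, n1 <= n ->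
  forall v, A n v -> exists v' u, [/\ N' n v', A (n - 1) u
    & v = v' + line_form t *: u].
Proof.
have [d [h H]] := local_gens (line_point_fin t).
exists (\sum_i `|d i - F`_i|) => n le_n v hv.
have kA m := section_ksub k F m.
rewrite (sum_basis v); elim/big_ind: _ => [|a b|i _].
- exists 0, 0; rewrite scaler0 addr0; split=> //; first exact: gsub0.
  exact: (ksub0 (kA _)).
- move=> [va [ua [Na ha ->]]] [vb [ub [Nb hb ->]]].
  exists (va + vb), (ua + ub); split; first exact: gsubD.
    exact: (ksubD (kA _)).
  by rewrite scalerDr addrACA.
have [hd h0 Nh] := H i.
have le_i : d i - F`_i <= n.
  apply: le_trans le_n; apply: le_trans (ler_norm _) _.
  by rewrite (bigD1 i) //= lerDl sumr_ge0.
have [e He] : exists e : nat, F`_i + n = e%:Z + d i.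
  by exists `|(F`_i + n - d i)%R|%N; rewrite gez0_abs ?subrK //; lia.
pose c := (v i 0).@[line_point t 1] / (h i).@[line_point t 1].
pose g := v i 0 - c%:MP * 'X_1 ^+ e * h i.
have fh : is_form (F`_i + n) (c%:MP * 'X_1 ^+ e * h i).
  by rewrite He; apply: is_formM => //; apply/is_formZ/is_form_Xn.
have g0 : g.@[line_point t 1] = 0.
  by rewrite mevalB !mevalM mevalC rmorphXn /= mevalXU expr1n mulr1 divfK ?subrr.
have [g1 [g2 [g3 [f1 f2 f3 Eg]]]] := form_point_ideal (is_formB (hv i) fh) g0.
have sg (f : S) : is_form (F`_i + n - 1) f -> A (n - 1) (f *: delta_mx i 0).
  move=> ff; have := sectionZ ff (@basis_section i).
  by rewrite (_ : F`_i + n - 1 + (- F`_i) = n - 1) //; ring.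
exists ((c%:MP * 'X_1 ^+ e) *: (h i *: delta_mx i 0)
  + (x2 *: (g2 *: delta_mx i 0) + x3 *: (g3 *: delta_mx i 0))), (g1 *: delta_mx i 0).
split.
- apply: (gsubD gN'); last by apply: x23N'; apply: sg.
  apply: NN'; rewrite (_ : n = e%:Z + (d i - F`_i)); last by rewrite addrA -He; ring.
  by apply: gsubZ => //; apply/is_formZ/is_form_Xn.
- exact: sg.
- rewrite !scalerA -!scalerDl; congr (_ *: _).
  have -> : v i 0 = g + c%:MP * 'X_1 ^+ e * h i by rewrite /g subrK.
  rewrite -/g in Eg; rewrite Eg; ring.
Qed.

(* Induction on m: a zero of H on the line splits off a linear factor of H modulo
   (x_2, x_3), to which [quotient_line_point] applies. *)
Let quotient_form (m : nat) (H : S) : is_form m H -> H.@[line_point 1 0] != 0 ->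
  exists n1 : int, forall n : int, n1 <= n -> forall v, A n v ->
  exists v' u, [/\ N' n v', A (n - m%:Z) u & v = v' + H *: u].
Proof.
elim: m H => [|m IH] H hH H0.
  have [c Ec] := is_form_const hH; exists 0 => n _ v hv.
  exists 0, (c^-1%:MP *: v); rewrite subr0 add0r; split; first exact: gsub0.
    exact: (ksubZ (section_ksub k F _)).
  rewrite scalerA Ec -mpolyCM divff ?mpolyC1 ?scale1r //.
  by move: H0; rewrite Ec mevalC.
have [t Ht] := form_line_root hH H0.
have [G [g2 [g3 [hG h2 h3 EH]]]] := form_point_ideal hH Ht.
have predm : m.+1%:Z - 1 = m%:Z by lia.
rewrite predm in hG h2 h3.
have G0 : G.@[line_point 1 0] != 0.
  move: H0; rewrite EH /line_form !mevalD !mevalM !mevalB mevalM mevalC !mevalXU.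
  by rewrite /line_point /= mulr0 subr0 mul1r !mul0r !addr0.
have [nG HG] := IH G hG G0.
have [nt Hl] := quotient_line_point t.
exists (Num.max nG (nt + m%:Z)) => n; rewrite ge_max => /andP[leG let_] v hv.
have [v' [u [Nv' hu ->]]] := HG n leG v hv.
have [|u' [w [Nu' hw ->]]] := Hl (n - m%:Z) _ u hu; first by lia.
have Em : n - m%:Z - 1 = n - m.+1%:Z by lia.
exists (v' + G *: u' - (x2 *: (g2 *: w) + x3 *: (g3 *: w))), w; split.
- apply: (gsubD gN').
    apply: (gsubD gN') => //.
    by have := gsubZ gN' hG Nu'; rewrite addrC subrK.
  rewrite opprD -!scalerN; apply: x23N';
    have <- : m%:Z + (n - m%:Z - 1) = n - 1 by ring.
  + by apply: sectionZ => //; exact: (ksubN (section_ksub k F _)).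
  + by apply: sectionZ => //; exact: (ksubN (section_ksub k F _)).
- by rewrite -Em.
- have -> : H *: w = (x2 *: (g2 *: w) + x3 *: (g3 *: w)) + G *: (line_form t *: w).
    by rewrite !scalerA -!scalerDl; congr (_ *: _); rewrite EH; ring.
  by rewrite scalerDr [RHS]addrA subrK addrA.
Qed.

(* The product H of local denominators at (1 : 0 : 0 : 0) satisfies H F <= N, so
   that the term H u provided by [quotient_form] is absorbed by N. *)
Let quotient_x23 : exists n1 : int, forall n : int, n1 <= n -> forall v, A n v -> N' n v.
Proof.
have [d [h H]] := local_gens (line_point_inf k).
have dnat i : exists m : nat, d i = m.
  by case: (H i); case: (d i) => [m|m] /= => [|/eqP->]; [exists m|rewrite meval0 eqxx].
have [m Em] := fin_all_exists dnat.
pose P := \prod_i h i; pose M := (\sum_i m i)%N.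
have hP : is_form M P.
  rewrite /P /M; elim/big_ind2: _ => [|a f b g ha hb|i _].
  - by rewrite -mpolyC1 is_formC.
  - by rewrite PoszD; apply: is_formM.
  - by case: (H i); rewrite Em.
have P0 : P.@[line_point 1 0] != 0.
  by rewrite rmorph_prod prodf_seq_neq0; apply/allP => i _; case: (H i).
have [n1 Hn1] := quotient_form hP P0.
exists n1 => n le_n v /(Hn1 n le_n)[v' [u [Nv' hu ->]]].
apply: (gsubD gN') => //; apply: NN'.
rewrite [u]sum_basis scaler_sumr.
elim/big_ind: _ => [|a b|i _]; [exact: gsub0|exact: gsubD|].
have [hd _ Nh] := H i.
rewrite /P (bigD1 i) //= scalerA mulrC mulrCA mulrC -scalerA.
pose D := n - (d i - F`_i).
have -> : n = D + (d i - F`_i) by rewrite subrK.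
apply: gsubZ => //.
have -> : D = (F`_i + (n - M%:Z)) + (\sum_(j | j != i) m j)%N.
  rewrite /D /M [X in n - Posz X](bigD1 i) //= PoszD Em; ring.
apply: is_formM => //.
elim/big_ind2: _ => [|a f b g ha hb|j _].
- by rewrite -mpolyC1 is_formC.
- by rewrite PoszD; apply: is_formM.
- by case: (H j); rewrite Em.
Qed.

(** Iterating [quotient_x23] from degree n down to a fixed degree n_0 leaves the
    multiples of a basis of F_(n_0) by the n - n_0 + 1 monomials of degree
    n - n_0 in x_2 and x_3. *)
Lemma cokernel_growth : exists K n1 : nat, forall n : nat, (n1 <= n)%N ->
  exists (J : finType) (f : J -> 'cV[S]_(size F)),
    (#|J| <= K * n.+1)%N /\ kspan (A n%:Z) (N n%:Z) f.
Proof.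
have [n1 Hn1] := quotient_x23.
pose n0 := `|n1|%N.
have [I [b [_ _ span_b _]]] := sections_basis k F n0.
have mono j v : A (n0 + j)%N%:Z v -> exists u : nat -> 'cV[S]_(size F),
    (forall a, A n0 (u a)) /\
    N (n0 + j)%N (v - \sum_(a < j.+1) (x2 ^+ a * x3 ^+ (j - a)) *: u a).
  elim: j v => [|j IH] v.
    rewrite addn0 => hv; exists (fun _ => v); split=> //.
    by rewrite big_ord1 expr0 mul1r expr0 scale1r subrr; apply: gsub0.
  move=> hv; have [|w [v2 [v3 [Nw h2 h3 Ev]]]] := Hn1 _ _ v hv.
    by rewrite /n0; lia.
  have Ej : (n0 + j.+1)%N%:Z - 1 = (n0 + j)%N by lia.
  rewrite Ej in h2 h3.
  have [u2 [hu2 Nu2]] := IH _ h2; have [u3 [hu3 Nu3]] := IH _ h3.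
  (* multiplication by x_2 shifts the exponent a, multiplication by x_3 does not *)
  exists (fun a => (if a is a'.+1 then u2 a' else 0)
                   + (if (a <= j)%N then u3 a else 0)); split.
    have [S0 SD _] := section_ksub k F n0.
    by move=> a; apply: SD; [case: a => [|a]|case: ifP => _].
  under eq_bigr do rewrite scalerDr.
  rewrite big_split /= [X in _ - (X + _)]big_ord_recl [X in _ - (_ + X)]big_ord_recr /=.
  rewrite ltnn !scaler0 add0r addr0.
  set s2 := \sum_(a < j.+1) _ *: u2 _ in Nu2; set s3 := \sum_(a < j.+1) _ *: u3 _ in Nu3.
  have -> : \sum_(i < j.+1) (x2 ^+ bump 0 i * x3 ^+ (j.+1 - bump 0 i)) *: u2 i
      = x2 *: s2.
    rewrite scaler_sumr; apply: eq_bigr => i _.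
    by rewrite /bump leq0n add1n subSS scalerA mulrA -exprS.
  have -> : \sum_(i < j.+1) (x2 ^+ i * x3 ^+ (j.+1 - i)) *:
        (if (i <= j)%N then u3 i else 0) = x3 *: s3.
    rewrite scaler_sumr; apply: eq_bigr => i _.
    have le_i : (i <= j)%N by rewrite -ltnS.
    by rewrite le_i scalerA mulrCA -exprS subSn.
  have -> : v - (x2 *: s2 + x3 *: s3) = w + x2 *: (v2 - s2) + x3 *: (v3 - s3).
    by rewrite Ev !scalerBr opprD addrACA !addrA.
  have -> : (n0 + j.+1)%N%:Z = 1 + (n0 + j)%N%:Z by lia.
  apply: (gsubD gN); last by apply: (gsubZ gN) => //; apply: is_formX.
  apply: (gsubD gN); last by apply: (gsubZ gN) => //; apply: is_formX.
  by move: Nw; congr (N _ w); lia.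
exists #|I|, n0 => n le_n.
have [j ->] : exists j, n = (n0 + j)%N by exists (n - n0)%N; rewrite subnKC.
exists ('I_j.+1 * I)%type, (fun p : 'I_j.+1 * I => (x2 ^+ p.1 * x3 ^+ (j - p.1)) *: b p.2).
split; first by rewrite card_prod card_ord mulnC leq_mul2l; apply/orP; right; lia.
move=> v /mono[u [hu Nv]].
have /fin_all_exists[c Hc] (a : 'I_j.+1) : exists c, u a = klin c b.
  by have [c /eqP] := span_b _ (hu a); rewrite subr_eq0 => /eqP; exists c.
exists (fun p => c p.1 p.2); congr (N _ (v - _)): Nv.
rewrite /klin -(pair_bigA _ (fun a s => (c a s)%:MP *:
   ((x2 ^+ a * x3 ^+ (j - a)) *: b s))) /=.
apply: eq_bigr => a _; rewrite Hc scaler_sumr; apply: eq_bigr => s _.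
by rewrite !scalerA mulrC.
Qed.

End CokernelBound.

(** * Rank and nullity *)

Section RankNullity.
Variables (k : fieldType) (n : nat) (V W : lmodType {mpoly k[n]}).
Variables (phi : {linear V -> W}) (B : V -> Prop).
Hypothesis kB : ksubspace B.
Variables (I H J L : finType) (g : I -> V) (h : H -> V) (f : J -> W) (m : L -> W).

(** dim B <= dim (ker phi) + dim (phi B), in terms of families spanning
    the kernel and a target of phi. *)
Lemma rank_nullity_leq :
  (forall i, B (g i)) -> kfree (@zerov _ _ _) g ->
  (forall v, B v -> phi v = 0 -> exists c, v = klin c h) ->
  (forall v, B v -> exists c, phi v = klin c f) ->
  (#|I| <= #|H| + #|J|)%N.
Proof.
move=> Bg free_g span_h span_f.
have [|r [Y [le_r Yg freeY]]] := @exists_relations k n W _ _ _ (phi \o g) f (zerov_ksub _).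
  by move=> i; have [c Hc] := span_f _ (Bg i); exists c; rewrite /zerov /= Hc subrr.
apply: leq_trans le_r _; rewrite leq_add2r -(card_ord r).
apply: (@kfree_leq_kspan _ _ _ (@zerov _ _ _) _ _ (fun s => klin (Y s) g) h).
- exact: zerov_ksub.
- move=> s; have [||c ->] := span_h (klin (Y s) g).
  + exact: ksub_klin.
  + by rewrite klin_morph; apply: Yg.
  + by exists c; rewrite /zerov subrr.
- by move=> c; rewrite klin_comp => /free_g; apply: freeY.
Qed.

(** dim (ker phi) + dim (phi B) <= dim B, where the dimension of phi B is bounded
    below by that of a target which [m] spans modulo phi B. *)
Lemma rank_nullity_geq :
  (forall v, B v -> exists c, v = klin c g) ->
  (forall i, B (h i) /\ phi (h i) = 0) -> kfree (@zerov _ _ _) h ->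
  kfree (@zerov _ _ _) f ->
  (forall j, exists (c : L -> k) (u : V), B u /\ f j = phi u + klin c m) ->
  (#|H| + #|J| <= #|I| + #|L|)%N.
Proof.
move=> span_g Bh free_h free_f span_m.
pose R (w : W) := exists2 u, B u & w = phi u.
have kR : ksubspace R.
  split.
  - by exists 0; rewrite ?linear0 //; apply: ksub0.
  - move=> _ _ [u hu ->] [v hv ->]; exists (u + v); rewrite ?linearD //.
    exact: ksubD.
  - by move=> c _ [u hu ->]; exists (c%:MP *: u); rewrite ?linearZ //; apply: ksubZ.
have [|r [Y [le_r Rf freeY]]] := @exists_relations k n W R _ _ f m kR.
  move=> j; have [c [u [hu ->]]] := span_m j.
  by exists c, u => //; rewrite addrK.
have /fin_all_exists[u Hu] : forall s, exists u, B u /\ klin (Y s) f = phi u.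
  by move=> s; have [u] := Rf s; exists u.
apply: leq_trans (leq_add (leqnn #|H|) le_r) _; rewrite addnA leq_add2r.
rewrite -[r]card_ord -card_sum.
pose hu (p : H + 'I_r) := match p with inl i => h i | inr s => u s end.
apply: (@kfree_leq_kspan _ _ _ (@zerov _ _ _) _ _ hu g).
- exact: zerov_ksub.
- have Bhu p : B (hu p) by case: p => [i|s] /=; [case: (Bh i)|case: (Hu s)].
  move=> p; have [c ->] := span_g _ (Bhu p).
  by exists c; rewrite /zerov subrr.
- move=> c; rewrite /zerov klin_sum => Ec.
  have c_inr s : c (inr s) = 0.
    apply: (freeY (c \o inr)) => i; apply: (free_f (fun i => \sum_s _ * Y s i)).
    rewrite /zerov -klin_comp.
    have := congr1 phi Ec; rewrite linearD linear0 !klin_morph.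
    rewrite [X in X + _](_ : _ = 0) ?add0r.
      move=> E; rewrite -[RHS]E; apply: eq_bigr => t _ /=.
      by case: (Hu t) => _ ->.
    by apply: big1 => t _ /=; case: (Bh t) => _ ->; rewrite scaler0.
  move: Ec; rewrite [X in _ + X]klin0 // addr0 => /free_h c_inl.
  by case=> [i|s]; [apply: c_inl|apply: c_inr].
Qed.

End RankNullity.

(** * The intersection of a line subbundle with the image of beta *)

Section Sheaves.
Variable k : closedFieldType.
Local Notation S := {mpoly k[4]}.

Lemma mulmx_klin p q (M : 'M[S]_(p, q)) (I : finType) (c : I -> k) e :
  M *m klin c e = klin c (fun i => M *m e i : 'cV_p).
Proof. by rewrite /klin mulmx_sumr; apply: eq_bigr => i _; rewrite scalemxAr. Qed.

Lemma im_graded (F G : seq int) (M : 'M[S]_(size G, size F)) :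
  is_mor M -> graded_submodule (im M).
Proof.
move=> hM; split.
- by move=> n _ [u hu ->]; rewrite -[n]add0r; apply: mor_section.
- by move=> n; exists 0; rewrite ?mulmx0 //; apply: (ksub0 (section_ksub k F n)).
- move=> n _ _ [u hu ->] [v hv ->]; exists (u + v); rewrite ?mulmxDr //.
  exact: (ksubD (section_ksub k F n)).
- move=> d n f _ hf [u hu ->]; exists (f *: u); first exact: sectionZ.
  by rewrite -scalemxAr.
Qed.

Lemma gsub_ksub (F : seq int) (N : gsub k F) n :
  graded_submodule N -> ksubspace (N n).
Proof.
move=> gN; split; [exact: gsub0|exact: gsubD|].
by move=> c v Nv; have := gsubZ gN (is_formC c) Nv; rewrite add0r.
Qed.

Lemma dim_forms_mono (c d : int) : c <= d -> (dim_forms c <= dim_forms d)%N.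
Proof. by case: c d => [c|c] [d|d] //= le_cd; apply: leq_bin2l; lia. Qed.

Lemma dim_sections1 (d n : int) : dim_sections [:: d] n = dim_forms (d + n).
Proof. by rewrite /dim_sections big_seq1. Qed.

(** The submodule N of S(d) below is the inverse image of im beta.  If it
    contains some w0 <> 0, say l w0 = beta u0, a local left inverse L / h of beta
    gives beta L l = h l, first on w0 and then, since S is a domain, everywhere;
    hence N is all of S(d) at each point and has codimension O(n).  But N also
    embeds in S(c_j), where the j-th entry of u0 is not zero: if l w = beta u,
    then w u0 = w0 u, so that u_j determines w.  As c_j < d this is impossible. *)
Lemma line_bundle_inter (C B : seq int) (d : int)
    (beta : 'M[S]_(size B, size C)) (l : 'M[S]_(size B, size [:: d])) :
  is_mor beta -> sheaf_injective beta -> locally_left_invertible beta ->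
  is_mor l -> sheaf_injective l -> (forall c, c \in C -> c < d) ->
  forall n w, is_section n w -> im beta n (l *m w) -> w = 0.
Proof.
move=> mb ib lb ml il ltC n0 w0 hw0 [u0 hu0 Eu0].
apply/eqP; apply/negP => /negP nz_w0.
have nz_w00 : w0 0 0 != 0.
  apply: contra nz_w0 => /eqP z; apply/eqP/matrixP => i j.
  by rewrite !ord1 z mxE.
have [j nz_j] : exists j, u0 j 0 != 0.
  apply/existsP; apply: contraNT nz_w0; rewrite negb_exists => /forallP z.
  apply/eqP/(il n0); split=> //; rewrite Eu0.
  have -> : u0 = 0 by apply/matrixP => i i'; rewrite ord1 mxE; apply/eqP/negPn/z.
  by rewrite mulmx0.
pose N : gsub k [:: d] := fun n w => is_section n w /\ im beta n (l *m w).
have gim := im_graded mb.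
have gN : graded_submodule N.
  split.
  - by move=> n v [].
  - by move=> n; split; [apply: (ksub0 (section_ksub _ _ _))|rewrite mulmx0; apply: gsub0].
  - move=> n u v [hu bu] [hv bv]; split.
      exact: (ksubD (section_ksub k [:: d] n)).
    by rewrite mulmxDr; apply: gsubD.
  - move=> e n f v hf [hv bv]; split; first exact: sectionZ.
    by rewrite -scalemxAr; apply: gsubZ.
have fullN : subsheaf_le (@full k [:: d]) N.
  move=> p pp n w hw; have [e [h [L [hh hp mL EL]]]] := lb p pp.
  exists e, h; split=> //; split; first exact: sectionZ.
  have El : beta *m (L *m l) = h *: l.
    have Ew0 : beta *m (L *m l) *m w0 = h *: l *m w0.
      rewrite -!mulmxA Eu0 (mulmxA L) EL mul_scalar_mx -scalemxAr -Eu0.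
      by rewrite -scalemxAl.
    apply/matrixP => i z; rewrite ord1; apply: (mulIf nz_w00).
    by have /matrixP/(_ i 0) := Ew0; rewrite [LHS]mxE [RHS]mxE !big_ord1.
  exists (L *m (l *m w)).
    apply: mor_section => //; rewrite -[n]add0r; exact: mor_section.
  by rewrite mulmxA mulmxA -(mulmxA beta) El -scalemxAr -scalemxAl.
have [K [n1 HK]] := cokernel_growth gN fullN.
pose c := C`_j.
have lt_cd : c < d by apply/ltC/mem_nth/ltn_ord.
have bound (n : nat) : (n1 <= n)%N ->
    (dim_forms (d + n%:Z) <= dim_forms (c + n%:Z) + K * n.+1)%N.
  move=> le_n; have [J [f [leJ span_f]]] := HK n le_n.
  have [T [e [cT he span_e free_e]]] := sections_basis k [:: d] n.
  have [|r [Y [le_r NY freeY]]] := exists_relations (gsub_ksub n gN) (e := e) (f := f).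
    by move=> t; apply: span_f.
  rewrite -dim_sections1 -cT; apply: leq_trans le_r _.
  apply: leq_add => //; rewrite -dim_sections1.
  have [T' [e' [<- he' span_e' free_e']]] := sections_basis k [:: c] n.
  have /fin_all_exists[u Hu] (s : 'I_r) :
      exists u, is_section n u /\ l *m klin (Y s) e = beta *m u.
    by have [_ [u hu Eu]] := NY s; exists u.
  pose uj s : 'cV[S]_(size [:: c]) := const_mx (u s j 0).
  rewrite -[r]card_ord.
  apply: (@kfree_leq_kspan _ _ _ (@zerov _ _ _) _ _ uj e') => [|s|a].
  - exact: zerov_ksub.
  - apply: span_e' => i; rewrite mxE ord1 /=; case: (Hu s) => hu _; exact: hu.
  - move=> Ea; apply: freeY; apply: free_e; rewrite /zerov -klin_comp.
    set w := klin a _; pose v := klin a u.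
    have hv : is_section n v.
      by apply: ksub_klin => [|s]; [apply: section_ksub|case: (Hu s)].
    have hw : is_section n w.
      by apply: ksub_klin => [|s]; [apply: section_ksub|case: (NY s)].
    have Ev : l *m w = beta *m v.
      rewrite /w /v !mulmx_klin.
      by apply: eq_bigr => s _; case: (Hu s) => _ ->.
    have vj : v j 0 = 0.
      have /matrixP/(_ 0 0) := Ea; rewrite /v /klin !summxE mxE => E.
      by rewrite -[RHS]E; apply: eq_bigr => s _; rewrite !mxE.
    have fw : is_form (d + n) (w 0 0) by apply: (hw 0).
    have fw0 : is_form (d + n0) (w0 0 0) by apply: (hw0 0).
    have scalE (a1 a2 : 'cV[S]_(size [:: d])) : a1 0 0 *: a2 = a2 0 0 *: a1.
      by apply/matrixP => i i'; rewrite !ord1 !mxE mulrC.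
    (* both terms are sent by beta to l applied to w0 w *)
    have : w 0 0 *: u0 - w0 0 0 *: v = 0.
      apply: (ib (d + n + n0)); split; last first.
        by rewrite mulmxBr -!scalemxAr -Eu0 -Ev !scalemxAr scalE subrr.
      apply: (ksubB (section_ksub k C _)); first exact: sectionZ.
      by rewrite addrAC; apply: sectionZ.
    move/matrixP/(_ j 0); rewrite !mxE vj mulr0 subr0 => /eqP.
    rewrite mulf_eq0 (negbTE nz_j) orbF => /eqP w00.
    by apply/matrixP => i i'; rewrite !ord1 w00 mxE.
pose D := dim_poly d - dim_poly c.
have sD : (size D <= 2)%N.
  apply: (@size_leq2_linear_growth _ K%:R (n1 + `|c|)%N) => n le_n.
  rewrite hornerD hornerN !dim_polyE; try lia.
  have := bound n ltac:(lia); have := @dim_forms_mono (c + n) (d + n) ltac:(lia).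
  move=> le1 le2; rewrite -natrB // -natrM ger0_norm ?ler0n // ler_nat.
  by rewrite leq_subLR.
have : D`_2 = 0 by rewrite nth_default.
rewrite coefB !coef_Poly /= => E.
have /eqP : d%:~R = c%:~R :> rat by lra.
by rewrite eqr_int => /eqP E'; move: lt_cd; rewrite E' ltxx.
Qed.

(** * Rank and degree of the cohomology of a monad *)

Lemma twists_ge0 (F : seq int) : exists n0 : nat, forall n : nat, (n0 <= n)%N ->
  forall d, d \in F -> 0 <= d + n%:Z.
Proof.
exists (\sum_(d <- F) `|d|)%N => n le_n d dF.
suff : (`|d| <= n)%N by lia.
by apply: leq_trans le_n; rewrite (big_rem d dF) leq_addr.
Qed.

(** In degree n, ker alpha / im beta has dimension
    dim B_n - dim C_n - dim A_n, up to the dimension of A_n / im alpha_n. *)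
Lemma cohomology_growth (C B A : seq int) (beta : 'M[S]_(size B, size C))
    (alpha : 'M[S]_(size A, size B)) (P : {poly rat}) :
  monad beta alpha -> hilbert_poly (ker alpha) (im beta) P ->
  (size (P - (sections_poly B - sections_poly A - sections_poly C))%R <= 2)%N.
Proof.
move=> [mb ma ab0 ib _ sa] [n0 HP].
have [K [n1 HK]] := cokernel_growth (im_graded ma) sa.
have [n2 H2] := twists_ge0 (B ++ A ++ C).
apply: (@size_leq2_linear_growth _ K%:R (n0 + n1 + n2)%N) => n le_n.
have [D [e [ke span_e free_e]] PD] := HP n ltac:(lia).
have [J [m [leJ span_m]]] := HK n ltac:(lia).
have pos := H2 n ltac:(lia).
have [IB [gB [cB sB span_B free_B]]] := sections_basis k B n.
have [IA [gA [cA sA span_A free_A]]] := sections_basis k A n.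
have [IC [gC [cC sC span_C free_C]]] := sections_basis k C n.
have spanE (F : seq int) (I : finType) (g : I -> 'cV[S]_(size F)) v :
    kspan (@is_section k F n) (@zerov _ _ _) g -> is_section n v ->
    exists c, v = klin c g.
  by move=> sp /sp[c /eqP]; rewrite subr_eq0 => /eqP; exists c.
pose h (p : 'I_D + IC) := match p with inl i => e i | inr i => beta *m gC i end.
have kim := gsub_ksub n (im_graded mb).
have hB p : is_section n (h p) /\ alpha *m h p = 0.
  case: p => [i|i] /=; first by case: (ke i).
  rewrite mulmxA ab0 mul0mx; split=> //.
  by have := mor_section mb (sC i); rewrite add0r.
have span_h v : is_section n v -> alpha *m v = 0 -> exists c, v = klin c h.
  move=> hv av; have [c [u hu Eu]] := span_e v (conj hv av).
  have [c' Ec'] := spanE _ _ _ u span_C hu.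
  exists (fun p => match p with inl i => c i | inr i => c' i end).
  rewrite klin_sum -[LHS](subrK (\sum_i (c i)%:MP *: e i)) Eu addrC.
  by congr (_ + _); rewrite Ec' mulmx_klin.
have free_h : kfree (@zerov _ _ _) h.
  move=> c; rewrite /zerov klin_sum => Ec.
  have bE : klin (c \o inr) (h \o inr) = beta *m klin (c \o inr) gC.
    by rewrite mulmx_klin.
  have sbC : is_section n (klin (c \o inr) gC).
    by apply: ksub_klin => //; apply: section_ksub.
  have c_inl : forall i, (c \o inl) i = 0.
    apply: free_e; exists (- klin (c \o inr) gC).
      exact: (ksubN (section_ksub k C n)).
    by rewrite mulmxN -bE; apply/eqP; rewrite -addr_eq0; apply/eqP.
  move: Ec; rewrite klin0 // add0r bE => Ec.
  have c_inr := free_C _ (ib n _ (conj sbC Ec)).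
  by case=> i; [apply: c_inl|apply: c_inr].
have upper : (#|IB| <= D + #|IC| + #|IA|)%N.
  have := @rank_nullity_leq k 4 _ _ (mulmx alpha) _ (section_ksub k B n) IB _ IA
     gB h gA sB free_B span_h.
  rewrite card_sum card_ord; apply => v hv; apply: spanE => //.
  by have := mor_section ma hv; rewrite add0r.
have lower : (D + #|IC| + #|IA| <= #|IB| + #|J|)%N.
  have := @rank_nullity_geq k 4 _ _ (mulmx alpha) _ (section_ksub k B n) IB _ IA J
     gB h gA m (fun v hv => spanE _ _ _ v span_B hv) hB free_h free_A.
  rewrite card_sum card_ord; apply => j.
  have [c [u hu Eu]] := span_m _ (sA j).
  by exists c, u; split=> //; rewrite /= -Eu subrK.
rewrite !(hornerD, hornerN) PD !sections_polyE -?cB -?cA -?cC; first last.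
- by move=> d dB; apply: pos; rewrite !mem_cat dB ?orbT.
- by move=> d dB; apply: pos; rewrite !mem_cat dB ?orbT.
- by move=> d dB; apply: pos; rewrite !mem_cat dB ?orbT.
have up : #|IB|%:R <= D%:R + #|IC|%:R + #|IA|%:R :> rat.
  by rewrite -!natrD ler_nat.
have lo : D%:R + #|IC|%:R + #|IA|%:R <= #|IB|%:R + #|J|%:R :> rat.
  by rewrite -!natrD ler_nat.
have bJ : #|J|%:R <= K%:R * n.+1%:R :> rat by rewrite -natrM ler_nat.
rewrite ger0_norm; lra.
Qed.

Lemma hilbert_poly_leading (P Q : {poly rat}) :
  (size (P - Q)%R <= 2)%N -> hrank P = hrank Q /\ hdegree P = hdegree Q.
Proof.
move=> sPQ; rewrite /hdegree /hrank.
have E i : (1 < i)%N -> P`_i = Q`_i.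
  by move=> lt1i; apply/eqP; rewrite -subr_eq0 -coefB nth_default // (leq_trans sPQ).
by rewrite !E.
Qed.

Lemma hrankB (P Q : {poly rat}) : hrank (P - Q) = hrank P - hrank Q.
Proof. by rewrite /hrank coefB mulrBr. Qed.

Lemma hdegreeB (P Q : {poly rat}) : hdegree (P - Q) = hdegree P - hdegree Q.
Proof. by rewrite /hdegree hrankB coefB; ring. Qed.

Lemma cohomology_rank_degree (C B A : seq int) (beta : 'M[S]_(size B, size C))
    (alpha : 'M[S]_(size A, size B)) (P : {poly rat}) :
  monad beta alpha -> hilbert_poly (ker alpha) (im beta) P ->
  hrank P = (size B)%:R - (size A)%:R - (size C)%:R /\
  hdegree P = (\sum_(b <- B) b - \sum_(a <- A) a - \sum_(c <- C) c)%:~R.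
Proof.
move=> hm hP; have [-> ->] := hilbert_poly_leading (cohomology_growth hm hP).
by rewrite !hrankB !hdegreeB !hrank_sections !hdegree_sections !rmorphB.
Qed.

(** * Destabilising the cohomology *)

(** The entries of column j of alpha are forms of degree at most 0.  If one of
    them is a nonzero constant, then the image of the summand O(B_j) under alpha
    is the direct summand of A spanned by that column; pi projects onto it along
    the summands of A other than O(A_i). *)
Lemma minimal_top_column (C B A : seq int) (beta : 'M[S]_(size B, size C))
    (alpha : 'M[S]_(size A, size B)) (j : 'I_(size B)) :
  is_mor alpha -> minimal beta alpha -> (forall a, a \in A -> a <= B`_j) ->
  forall i, alpha i j = 0.
Proof.
move=> ma [min_alpha _] leA i; apply/eqP/negP => /negP nz_i.
have mor_ij (i' : 'I_(size A)) : is_form (A`_i' - B`_j) (alpha i' j).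
  by have := ma i' j; rewrite addr0.
have topA (i' : 'I_(size A)) : alpha i' j != 0 -> A`_i' = B`_j.
  move=> nz; apply/eqP; rewrite eq_le leA ?mem_nth //=.
  rewrite leNgt -subr_lt0; apply: contra nz => lt0.
  by rewrite (is_form_lt0 lt0 (mor_ij i')).
have [c Ec] : exists c : k, alpha i j = c%:MP.
  by apply: is_form_const; have := mor_ij i; rewrite topA // subrr.
have nz_c : c != 0 by apply: contra nz_i => /eqP E; rewrite Ec E mpolyC0.
pose l : 'M[S]_(size B, size [:: B`_j]) := delta_mx j 0.
pose pi : 'M[S]_(size A) := \matrix_(a, b) (if b == i then alpha a j * c^-1%:MP else 0).
have al a z : (alpha *m l) a z = alpha a j.
  rewrite mxE (bigD1 j) //= mxE !ord1 !eqxx mulr1 big1 ?addr0 // => t ne.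
  by rewrite mxE (negbTE ne) mulr0.
have piE (p : nat) (M : 'M[S]_(size A, p)) a b :
    (pi *m M) a b = alpha a j * c^-1%:MP * M i b.
  rewrite mxE (bigD1 i) //= mxE eqxx big1 ?addr0 // => t ne.
  by rewrite mxE (negbTE ne) mul0r.
have cc : c * c^-1 = 1 by rewrite divff.
have one_form (d : int) : d = 0 -> is_form d (1 : S).
  by move=> ->; rewrite -mpolyC1 is_formC.
apply: min_alpha; exists B`_j, l, pi; split.
- split.
    move=> a b; rewrite mxE !ord1 andbT; case: eqP => [->|_] /=.
      by apply: one_form; rewrite subrr.
    exact: is_form0.
  move=> p _; exists 0, 1, (delta_mx 0 j); split.
  + exact: one_form.
  + by rewrite meval1 oner_eq0.
  + move=> a b; rewrite mxE !ord1 /=; case: eqP => [->|_] /=.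
      by apply: one_form; rewrite subrr.
    exact: is_form0.
  + by rewrite mul_delta_mx; apply/matrixP => a b; rewrite !mxE !ord1 !eqxx.
- split.
  + move=> a b; rewrite mxE addr0; case: eqP => [->|_]; last exact: is_form0.
    by rewrite (topA i) // mulrC is_formZ.
  + apply/matrixP => a b; rewrite piE !mxE.
    by case: eqP => // _; rewrite ?mulr0 // Ec mulrA -mulrA -mpolyCM cc mpolyC1 mulr1.
  + apply/eqP => /matrixP/(_ i i); rewrite !mxE eqxx Ec -mpolyCM cc mpolyC1.
    by move/eqP; rewrite oner_eq0.
- have trivial_le (G : seq int) (N N' : gsub k G) :
    (forall n v, N n v -> N' n v) -> subsheaf_le N N'.
    move=> H p _ n v /H; exists 0, 1; rewrite add0r scale1r meval1 oner_eq0.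
    by split=> //; apply: one_form.
  split; apply: trivial_le => n _ [u hu ->].
  + exists (\col_a (if a == i then c%:MP * u 0 0 else 0)).
      move=> a; rewrite mxE; case: eqP => [->|_]; last exact: is_form0.
      by rewrite topA //; apply/is_formZ/(hu 0).
    apply/matrixP => a z; rewrite piE mxE big_ord1 al mxE eqxx mulrA -(mulrA _ _ c%:MP).
    by rewrite -mpolyCM mulVf // mpolyC1 mulr1 [z]ord1.
  + exists (const_mx (c^-1%:MP * u i 0)).
      move=> a; rewrite mxE ord1 /= -(topA i) //; apply/is_formZ/hu.
    apply/matrixP => a z; rewrite piE mxE big_ord1 al mxE ord1.
    by rewrite mulrA.
Qed.

(** The destabilising subsheaf is (O(d) + im beta) / im beta, for a summand
    O(d) of B.  It is isomorphic to O(d) by [line_bundle_inter], and so has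
    slope d, while the numerical hypotheses say that E has rank at least 2
    and slope at most d. *)
Theorem no_stable_minimal_monad (C B A : seq int) (d : int) :
  d \in B -> (forall a, a \in A -> a <= d) -> (forall c, c \in C -> c < d) ->
  (size A + size C + 1 < size B)%N ->
  \sum_(b <- B) b - \sum_(a <- A) a - \sum_(c <- C) c
    <= d * ((size B)%:Z - (size A)%:Z - (size C)%:Z) ->
  ~ has_stable_minimal_monad k C B A.
Proof.
move=> dB leA ltC rk deg [beta [alpha [hm hmin [P hP stab]]]].
have [mb ma ab0 ib lb _] := hm.
have [j Ej] : exists j : 'I_(size B), B`_j = d.
  have lt_j : (index d B < size B)%N by rewrite index_mem.
  by exists (Ordinal lt_j); rewrite /= nth_index.
pose l : 'M[S]_(size B, size [:: d]) := delta_mx j 0.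
have lE p (M : 'M[S]_(size [:: d], p)) b z : (l *m M) b z = if b == j then M 0 z else 0.
  by rewrite mxE big_ord1 mxE andbT; case: eqP => _; rewrite ?mul1r ?mul0r.
have ml : is_mor l.
  move=> a b; rewrite mxE !ord1 andbT; case: eqP => [->|_] /=.
    by rewrite Ej subrr -mpolyC1 is_formC.
  exact: is_form0.
have il : sheaf_injective l.
  move=> n v [_ /matrixP lv]; apply/matrixP => a b.
  by have := lv j b; rewrite lE eqxx [a]ord1 !mxE.
have al : alpha *m l = 0.
  apply/matrixP => i z; rewrite mxE (bigD1 j) //= big1 ?addr0.
    by rewrite (minimal_top_column ma hmin) ?mul0r ?mxE // Ej.
  by move=> t ne; rewrite mxE (negbTE ne) mulr0.
have inter := line_bundle_inter mb ib lb ml il ltC.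
have gb := im_graded mb; have gl := im_graded ml.
pose M' : gsub k B := fun n v => exists u w, [/\ im beta n u, im l n w & v = u + w].
have gM' : graded_submodule M'.
  split.
  - move=> n v [u [w [hu hw ->]]].
    by apply: (ksubD (section_ksub k B n)); [apply: gsub_section hu|apply: gsub_section hw].
  - by move=> n; exists 0, 0; split; rewrite ?addr0 //; apply: gsub0.
  - move=> n _ _ [u [w [hu hw ->]]] [u' [w' [hu' hw' ->]]].
    exists (u + u'), (w + w'); split; last by rewrite addrACA.
      exact: gsubD.
    exact: gsubD.
  - move=> e n f _ hf [u [w [hu hw ->]]]; exists (f *: u), (f *: w).
    by split; [apply: gsubZ|apply: gsubZ|rewrite scalerDr].
have leN : gsub_le (im beta) M'.
  by move=> n v hv; exists v, 0; split; rewrite ?addr0 //; apply: gsub0.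
have leM : gsub_le M' (ker alpha).
  move=> n v hv; split; first exact: gsub_section hv.
  have [_ [_ [[u _ ->] [w _ ->] ->]]] := hv.
  by rewrite mulmxDr !mulmxA ab0 al !mul0mx addr0.
have hP' : hilbert_poly M' (im beta) (sections_poly [:: d]).
  have [n0 Hn0] := twists_ge0 [:: d].
  exists n0 => n le_n; exists (dim_sections [:: d] n).
    have [I [g [<- sg span_g free_g]]] := sections_basis k [:: d] n.
    exists (fun s => l *m g (enum_val s)).
    have reidx (c : I -> k) : \sum_(s < #|I|) (c (enum_val s))%:MP *: (l *m g (enum_val s))
        = l *m klin c g.
      rewrite mulmx_klin /klin (reindex (fun s : 'I_#|I| => enum_val s)) //.
      by apply: onW_bij; apply: enum_val_bij.
    split.
    + move=> s; exists 0, (l *m g (enum_val s)); split; rewrite ?add0r //.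
        exact: gsub0.
      by exists (g (enum_val s)).
    + move=> _ [u [_ [hu [w hw ->] ->]]].
      have [c /eqP] := span_g w hw; rewrite subr_eq0 => /eqP Ew.
      by exists (fun s => c (enum_val s)); rewrite reidx -Ew addrK.
    + move=> c; have Ec s : c s = c (enum_rank (enum_val s : I)) by rewrite enum_valK.
      rewrite (eq_bigr (fun s => (c (enum_rank (enum_val s : I)))%:MP
                  *: (l *m g (enum_val s)))) => [|s _]; last by rewrite -Ec.
      rewrite (reidx (fun i => c (enum_rank i))) => /inter E s.
      rewrite Ec; apply: (free_g (fun i => c (enum_rank i))); apply: E.
      by apply: ksub_klin => //; apply: section_ksub.
  exact: sections_polyE (Hn0 n le_n).
have [rP dP] := cohomology_rank_degree hm hP.
have rP1 : 1 < hrank P.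
  have : (size A + size C + 1)%:R < (size B)%:R :> rat by rewrite ltr_nat.
  by rewrite !natrD rP; lra.
have := stab M' _ gM' leN leM hP'.
rewrite /slope hrank_sections hdegree_sections /= big_seq1 divr1 rP1 ?ltr01.
move/(_ isT); rewrite ltr_pdivlMr ?(lt_trans ltr01) // dP rP ltNge => /negP; apply.
move: deg; rewrite -(ler_int rat) rmorphM !rmorphB.
by [].
Qed.

End Sheaves.

Theorem lemma13 (k : closedFieldType) (char_k : [pchar k] =i pred0) :
  [/\ (* (P5) *)
      ~ has_stable_minimal_monad k
          [:: -3; -3] [:: 2; 0; 0; -1; -1; -3] [:: 2; 2],
      (* (P11) *)
      ~ has_stable_minimal_monad k
          [:: -2; -3; -3] [:: 2; 0; 0; 0; -1; -1; -1; -3] [:: 1; 2; 2]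
    & (* (P18) *)
      ~ has_stable_minimal_monad k
          [:: -3; -3; -3] [:: 2; 1; 1; 0; -1; -2; -2; -3] [:: 2; 2; 2]].
Proof.
by split; apply: (@no_stable_minimal_monad _ _ _ _ 2);
  rewrite ?unlock //=; apply/allP.
Qed.
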